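(* Let $k\ge 1$, let $a_1,\dots,a_k$ be positive integers, and let $C$ be a (positive or negative) symmetric staircase complex with steps $[a_1,a_2,\dots,a_k,a_k,\dots,a_1]$. Let $s=\sum_{i=1}^k a_i$ and $d=\sum_{i\text{ odd},\ i\le k}a_i$. Up to bifiltered chain homotopy equivalence and omitting acyclic direct summands, the involutive complex associated to $C$, with its Min-Max bifiltration, is the direct sum of two complexes, one represented by a single vertex $v_0$ on the diagonal and the other a staircase complex $S$. Here filtration levels are written as $(\mathrm{Min},\mathrm{Max})$ and $S$ has the same sign (positive or negative) as $C$. Specifically: (1) If $C$ is positive and $k$ is even, then $v_0$ has grading $1$ and is at filtration level $(d,d)$; $S$ is the staircase $[a_1,\dots,a_k]$ with homology at grading $0$, beginning at filtration level $(0,s)$ and ending at $(d,d)$. (2) If $C$ is positive and $k$ is odd, then $v_0$ has grading $1$ and is at filtration level $(d,d)$; $S$ is the staircase $[a_1,\dots,a_{k-1}]$ with homology at grading $0$, beginning at filtration level $(0,s)$. (3) If $C$ is negative and $k$ is even, then $v_0$ has grading $0$ and is at filtration level $(-d,-d)$; $S$ is the staircase $[a_1,\dots,a_k]$ with homology at grading $1$, beginning at filtration level $(-s,0)$ and ending at $(-d,-d)$. (4) If $C$ is negative and $k$ is odd, then $v_0$ has grading $0$ and is at filtration level $(-d,-d)$; $S$ is the staircase $[a_1,\dots,a_{k-1}]$ with homology at grading $1$, beginning at filtration level $(-s,0)$.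
   Context: All complexes are over $\mathbb{F}=\mathbb{Z}/2$, with differentials of degree $-1$. Staircases. A staircase with steps $[b_1,\dots,b_n]$ ($n$ even, $b_i>0$) beginning at the point $(p,q)$ has generators (vertices) $x_0,\dots,x_n$ placed at lattice points (first coordinate = first filtration level, second coordinate = second filtration level), with $x_0$ at $(p,q)$. - Positive staircase: the steps go alternately right and down, the first to the right. So $x_i=x_{i-1}+(b_i,0)$ in position for $i$ odd and $x_i=x_{i-1}-(0,b_i)$ for $i$ even. The differential is $\partial x_i=x_{i-1}+x_{i+1}$ for $i$ odd and $\partial x_i=0$ for $i$ even. The odd-index generators have grading one more than the even-index ones. - Negative staircase: the steps go alternately down and right, the first down. So $x_i=x_{i-1}-(0,b_i)$ for $i$ odd and $x_i=x_{i-1}+(b_i,0)$ for $i$ even. The differential is $\partial x_i=x_{i-1}+x_{i+1}$ for $i$ even (with $x_{-1}=x_{n+1}=0$) and $\partial x_i=0$ for $i$ odd. The odd-index generators have grading one less than the even-index ones. In both cases the homology of the staircase is one-dimensional, in the grading of the even-index generators. ''Homology at grading $g$'' means that this grading is $g$. The actual complex is obtained from each such finite model (and likewise from the single vertex $v_0$, which has zero differential) by tensoring with $\mathbb{F}[U,U^{-1}]$, where $U$ lowers gradings by $2$ and both filtration levels by $1$. Symmetric staircase $C$. The model for $C$ has $n=2k$ and steps $[a_1,\dots,a_k,a_k,\dots,a_1]$, with coordinates $(\mathrm{alg},\mathrm{Alex})$ and homology at grading $0$. It begins at $(0,s)$ and ends at $(s,0)$ if positive, and begins at $(-s,0)$ and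 ends at $(0,-s)$ if negative. (Such complexes arise as $\mathrm{CFK}^\infty$ of $L$-space knots (positive) and of their mirror images (negative).) The skew involution $\mathcal{I}$ on $C$ is reflection through the diagonal, i.e. the $\mathbb{F}[U,U^{-1}]$-linear map with $x_j\mapsto x_{2k-j}$. Involutive complex. The involutive complex associated to $C$ is the mapping cone of $\mathcal{I}+I$, where $I$ is the identity: the graded vector space $C[1]\oplus C$, where $C[1]$ is $C$ with gradings shifted up by $1$, with boundary $(z_1,z_2)\mapsto(\partial z_1,\mathcal{I}(z_1)+z_1+\partial z_2)$. Min-Max (folded) bifiltration. A generator $x$ (an $x_j$ or a $U$-translate of it, in either copy of $C$) has $\mathrm{Min}(x)=\min\{\mathrm{alg}(x),\mathrm{Alex}(x)\}$ and $\mathrm{Max}(x)=\max\{\mathrm{alg}(x),\mathrm{Alex}(x)\}$, and the level-$i$ subcomplex of each filtration is the span of the generators of level at most $i$. A bifiltered chain homotopy equivalence is a chain homotopy equivalence in which the map, its homotopy inverse and the homotopies all preserve both filtrations. ''Acyclic'' means having zero homology. *)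

(* Defs.v *)
From HB Require Import structures.
From mathcomp Require Import all_boot all_order all_algebra.
From mathcomp Require Import finmap monalg.

Set Implicit Arguments.
Unset Strict Implicit.
Unset Printing Implicit Defensive.

Import Order.TTheory GRing.Theory Num.Theory.
Local Open Scope ring_scope.

HB.lock Definition lin_ext (K : choiceType) (V : lmodType 'F_2) (h : K -> V)
    (v : {malg 'F_2[K]}) : V :=
  \sum_(b <- msupp v) v@_b *: h b.

Section LinearExtension.
Variables (K : choiceType) (V : lmodType 'F_2) (h : K -> V).

Lemma lin_extE v : lin_ext h v = \sum_(b <- msupp v) v@_b *: h b.
Proof. by rewrite unlock. Qed.

Lemma lin_ext_wide (D : {fset K}) v : (msupp v `<=` D)%fset ->
  lin_ext h v = \sum_(b <- D) v@_b *: h b.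
Proof.
move=> le; rewrite lin_extE (big_fset_incl _ le) // => b _ /mcoeff_outdom ->.
by rewrite scale0r.
Qed.

Fact lin_ext_is_linear : linear (lin_ext h).
Proof.
move=> c u v; pose D := (msupp u `|` msupp v)%fset.
have uD : (msupp u `<=` D)%fset by apply: fsubsetUl.
have vD : (msupp v `<=` D)%fset by apply: fsubsetUr.
have wD : (msupp (c *: u + v) `<=` D)%fset.
  apply: fsubset_trans (msuppD_le _ _) _; rewrite fsubUset vD andbT.
  exact: fsubset_trans (msuppZ_le _ _) uD.
rewrite (lin_ext_wide uD) (lin_ext_wide vD) (lin_ext_wide wD).
rewrite scaler_sumr -big_split /=; apply: eq_bigr => b _.
by rewrite mcoeffD mcoeffZ scalerDl scalerA.
Qed.

HB.instance Definition _ :=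
  GRing.isLinear.Build 'F_2 {malg 'F_2[K]} V *:%R (lin_ext h) lin_ext_is_linear.

End LinearExtension.

(* [chain X] is the free F[U, U^-1]-module on X, F = 'F_2, presented by its
   F-basis of U-translates of elements of X: the pair (x, m) stands for U^m x. *)
Definition chain (X : finType) : Type := {malg 'F_2[(X * int)%type]}.

HB.instance Definition _ (X : finType) := GRing.Lmodule.on (chain X).

Definition vec (X : finType) (x : X) : chain X := << (x, 0) >>.

Definition Upow (X : finType) (m : int) (v : chain X) : chain X :=
  lin_ext (fun b : X * int => << (b.1, b.2 + m) >> : chain X) v.

HB.instance Definition _ (X : finType) (m : int) :=
  GRing.isLinear.Build 'F_2 (chain X) (chain X) *:%R (@Upow X m)
    (@lin_ext_is_linear _ _ _).

(* the F[U, U^-1]-linear extension of a map defined on X *)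
Definition Ulin_ext (X Y : finType) (h : X -> chain Y) (v : chain X) : chain Y :=
  lin_ext (fun b : X * int => Upow b.2 (h b.1)) v.

HB.instance Definition _ (X Y : finType) (h : X -> chain Y) :=
  GRing.isLinear.Build 'F_2 (chain X) (chain Y) *:%R (@Ulin_ext X Y h)
    (@lin_ext_is_linear _ _ _).

(* The data of a graded complex, free over F[U, U^-1], with a finite basis of
   homogeneous elements of given levels for two filtrations.  The axioms that
   make it a bifiltered chain complex are in [is_complex]. *)
Record bifiltered := Bifiltered {
  gen : finType;
  deg : gen -> int;
  lev1 : gen -> int;
  lev2 : gen -> int;
  bd : gen -> chain gen
}.

Section Complexes.
Variable A : bifiltered.

Definition diff : chain (gen A) -> chain (gen A) := Ulin_ext (@bd A).

HB.instance Definition _ := GRing.Linear.on diff.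

(* U lowers degrees by 2 and both filtration levels by 1 *)
Definition basis_deg (b : gen A * int) : int := deg b.1 - b.2 *+ 2.
Definition basis_lev1 (b : gen A * int) : int := lev1 b.1 - b.2.
Definition basis_lev2 (b : gen A * int) : int := lev2 b.1 - b.2.

Definition homogeneous (g : int) (v : chain (gen A)) : Prop :=
  forall b, b \in msupp v -> basis_deg b = g.

Definition in_filt1 (i : int) (v : chain (gen A)) : Prop :=
  forall b, b \in msupp v -> basis_lev1 b <= i.

Definition in_filt2 (i : int) (v : chain (gen A)) : Prop :=
  forall b, b \in msupp v -> basis_lev2 b <= i.

End Complexes.

Arguments diff A v : clear implicits.

(* f is F[U, U^-1]-linear, of degree r, and preserves both filtrations *)
Record bifiltered_map (A B : bifiltered) (r : int)
    (f : {linear chain (gen A) -> chain (gen B)}) : Prop := BifilteredMap {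
  map_U : forall v, f (Upow 1 v) = Upow 1 (f v);
  map_deg : forall g v, homogeneous g v -> homogeneous (g + r) (f v);
  map_filt1 : forall i v, in_filt1 i v -> in_filt1 i (f v);
  map_filt2 : forall i v, in_filt2 i v -> in_filt2 i (f v)
}.

Definition is_complex (A : bifiltered) : Prop :=
  bifiltered_map (- 1) (diff A) /\ forall v, diff A (diff A v) = 0.

Definition acyclic (A : bifiltered) : Prop :=
  forall v, diff A v = 0 -> exists w, diff A w = v.

Definition chain_map (A B : bifiltered)
    (f : {linear chain (gen A) -> chain (gen B)}) : Prop :=
  bifiltered_map 0 f /\ forall v, f (diff A v) = diff B (f v).

Definition homotopic_to_id (A : bifiltered)
    (f : chain (gen A) -> chain (gen A)) : Prop :=
  exists h : {linear chain (gen A) -> chain (gen A)},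
    bifiltered_map 1 h /\ forall v, f v - v = diff A (h v) + h (diff A v).

Definition homotopy_equivalent (A B : bifiltered) : Prop :=
  exists (f : {linear chain (gen A) -> chain (gen B)})
         (g : {linear chain (gen B) -> chain (gen A)}),
    [/\ chain_map f, chain_map g,
        homotopic_to_id (g \o f) & homotopic_to_id (f \o g)].

Definition to_inl (X Y : finType) : chain X -> chain (X + Y)%type :=
  Ulin_ext (fun x : X => @vec (X + Y)%type (inl x)).

HB.instance Definition _ (X Y : finType) := GRing.Linear.on (@to_inl X Y).

Definition to_inr (X Y : finType) : chain Y -> chain (X + Y)%type :=
  Ulin_ext (fun y : Y => @vec (X + Y)%type (inr y)).

HB.instance Definition _ (X Y : finType) := GRing.Linear.on (@to_inr X Y).

Definition sum_case (X Y : finType) (T : Type) (f : X -> T) (g : Y -> T)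
    (z : X + Y) : T :=
  match z with inl x => f x | inr y => g y end.

Definition dsum (A B : bifiltered) : bifiltered := {|
  gen := (gen A + gen B)%type;
  deg := sum_case (@deg A) (@deg B);
  lev1 := sum_case (@lev1 A) (@lev1 B);
  lev2 := sum_case (@lev2 A) (@lev2 B);
  bd := sum_case (fun x => to_inl (gen B) (bd x))
                 (fun y => to_inr (gen A) (bd y))
|}.

(* The complement Z is only required to have zero homology: it need not be
   contractible by a homotopy preserving the filtrations. *)
Definition equivalent_up_to_acyclic (A B : bifiltered) : Prop :=
  exists Z : bifiltered,
    [/\ is_complex Z, acyclic Z & homotopy_equivalent A (dsum B Z)].

Definition single_vertex (p : int * int) (g : int) : bifiltered := {|
  gen := unit;
  deg := fun=> g;
  lev1 := fun=> p.1;
  lev2 := fun=> p.2;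
  bd := fun=> 0
|}.

Variant sign := Positive | Negative.
Definition is_positive (e : sign) : bool := if e is Positive then true else false.

(* Position of x_i; the step b_i leading to x_i is the entry i.-1 of b.
   It goes right for i odd (positive case), resp. for i even (negative case). *)
Fixpoint vertex (e : sign) (b : seq nat) (p : int * int) (i : nat) : int * int :=
  if i is j.+1 then
    let q := vertex e b p j in
    if odd j.+1 == is_positive e then (q.1 + (nth 0%N b j)%:Z, q.2)
    else (q.1, q.2 - (nth 0%N b j)%:Z)
  else p.

Definition end_vertex (e : sign) (b : seq nat) (p : int * int) : int * int :=
  vertex e b p (size b).

(* Steps b, beginning at p, with even-index generators in grading g.
   Meaningful when size b is even. *)
Definition staircase (e : sign) (b : seq nat) (p : int * int) (g : int) :
    bifiltered := {|
  gen := 'I_(size b).+1;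
  deg := fun i => if odd i then (if e is Positive then g + 1 else g - 1) else g;
  lev1 := fun i => (vertex e b p i).1;
  lev2 := fun i => (vertex e b p i).2;
  bd := fun i =>
    if odd i == is_positive e then
      \sum_(j : 'I_(size b).+1 | (j.+1 == i) || (j == i.+1 :> nat)) vec j
    else 0
|}.

(* The mapping cone of iota + id, for the F[U, U^-1]-linear extension of a map
   iota on generators, with the levels of C folded to (Min, Max).
   The left summand is C[1]. *)
Definition involutive_complex (C : bifiltered) (iota : gen C -> gen C) :
    bifiltered := {|
  gen := (gen C + gen C)%type;
  deg := sum_case (fun x : gen C => deg x + 1) (fun x : gen C => deg x);
  lev1 := let m (x : gen C) := Num.min (lev1 x) (lev2 x) in sum_case m m;
  lev2 := let m (x : gen C) := Num.max (lev1 x) (lev2 x) in sum_case m m;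
  bd := sum_case
    (fun x => to_inl (gen C) (bd x)
              + to_inr (gen C) (vec (iota x) + vec x))
    (fun x => to_inr (gen C) (bd x))
|}.

Definition symmetric_staircase (e : sign) (k : nat) (a : k.-tuple nat) :
    bifiltered :=
  let s : int := \sum_(i < k) (tnth a i)%:Z in
  staircase e (a ++ rev a) (if e is Positive then (0, s) else (- s, 0)) 0.

(* rev_ord maps x_j to x_{2k-j}. *)
Definition staircase_involutive (e : sign) (k : nat) (a : k.-tuple nat) :
    bifiltered :=
  @involutive_complex (symmetric_staircase e a) (@rev_ord _).

(* Main.v *)
Require Import Defs.
From mathcomp Require Import all_boot all_order all_algebra.
From mathcomp Require Import finmap monalg zify.

Set Implicit Arguments.
Unset Strict Implicit.
Unset Printing Implicit Defensive.

Import Order.TTheory GRing.Theory Num.Theory.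
Local Open Scope ring_scope.

(** Write x_0, ..., x_2k for the vertices of C. The involutive complex has two
    copies of them: y_i, in C[1], and z_i, in C, and the boundary of y_i is the
    copy of the boundary of x_i plus z_i + z_(2k-i). Reflection in the diagonal
    exchanges the coordinates of x_i and x_(2k-i), so these two vertices have
    the same Min and the same Max, namely the coordinates of the one which lies
    on the first half of the staircase ([vertex_fold]). Hence for i < k the
    component y_i -> z_i + z_(2k-i) of the boundary preserves both folded
    levels, and y_i can be cancelled against z_i + z_(2k-i) by a bifiltered
    homotopy equivalence ([cone_retract]). Two half staircases x_0, ..., x_k
    remain: one spanned by the y_i + y_(2k-i), i < k, and y_k, the other by the
    z_i, i <= k.

    Only at the middle vertex do these halves differ from the first half of C.
    - Suppose that the boundary of x_k is not zero. Then the boundary of y_k is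
      y_(k-1) + y_(k+1), the last but one vertex of the first half, which is
      therefore a full staircase. But z_(k-1) + z_(k+1), the boundary of z_k,
      is also the boundary of y_(k-1), so that z_k + y_(k-1) is a cycle: the
      second half loses its last arrow.
    - Suppose that the boundary of x_k is zero. Then the arrow at the middle
      comes from x_(k-1). It survives in the second half, but in the first one
      y_k occurs twice in the boundary of y_(k-1) + y_(k+1) and cancels.
    In either case one half is a staircase with all k steps and the other one
    falls apart into its last vertex, which lies on the diagonal because C is
    symmetric, and a staircase with k - 1 steps
    ([involutive_staircase_retract]). A staircase with an odd number of steps
    is acyclic ([staircase_acyclic]), so the parity of k decides which of the
    two staircases is S and which one is discarded; the last vertex is v_0. *)

(** * U-linear maps on chains *)

Lemma msupp_basis (K : choiceType) (b : K) :
  msupp (<< b >> : {malg 'F_2[K]}) = [fset b]%fset.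
Proof. by rewrite msuppU oner_eq0. Qed.

Lemma lin_ext_basis (K : choiceType) (V : lmodType 'F_2) (h : K -> V) (b : K) :
  lin_ext h << b >> = h b.
Proof. by rewrite lin_extE msupp_basis big_seq_fset1 mcoeffUU scale1r. Qed.

Lemma eq_on_basis (X : finType) (V : lmodType 'F_2) (f g : {linear chain X -> V}) :
  (forall b, f << b >> = g << b >>) -> forall v, f v = g v.
Proof.
move=> eq_fg v; rewrite (monalgE v) !linear_sum; apply: eq_bigr => b _.
have -> : << v@_b *g b >> = v@_b *: << b >> :> {malg 'F_2[_]}.
  by apply/malgP => c; rewrite mcoeffZ !mcoeffU mulrnAr mulr1.
by rewrite !linearZ /= eq_fg.
Qed.

Lemma Upow_basis (X : finType) m (b : X * int) :
  Upow m << b >> = << (b.1, b.2 + m) >> :> chain X.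
Proof. exact: lin_ext_basis. Qed.

Lemma Upow0 (X : finType) (v : chain X) : Upow 0 v = v.
Proof.
apply: (eq_on_basis (f := @Upow X 0) (g := idfun)) => -[x m] /=.
by rewrite Upow_basis /= addr0.
Qed.

Lemma UpowD (X : finType) m n (v : chain X) : Upow (m + n) v = Upow n (Upow m v).
Proof.
apply: (eq_on_basis (f := @Upow X (m + n)) (g := @Upow X n \o @Upow X m)) => -[x p].
by rewrite /= !Upow_basis /= addrA.
Qed.

Lemma Ulin_ext_basis (X Y : finType) (h : X -> chain Y) b :
  Ulin_ext h << b >> = Upow b.2 (h b.1).
Proof. exact: lin_ext_basis. Qed.

Lemma Ulin_ext_vec (X Y : finType) (h : X -> chain Y) x : Ulin_ext h (vec x) = h x.
Proof. by rewrite Ulin_ext_basis /= Upow0. Qed.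

Lemma basisE (X : finType) (b : X * int) : << b >> = Upow b.2 (vec b.1) :> chain X.
Proof. by case: b => x m; rewrite Upow_basis add0r. Qed.

Lemma Ulin_ext_Upow (X Y : finType) (h : X -> chain Y) m v :
  Ulin_ext h (Upow m v) = Upow m (Ulin_ext h v).
Proof.
apply: (eq_on_basis (f := @Ulin_ext X Y h \o @Upow X m)
  (g := @Upow Y m \o @Ulin_ext X Y h)).
by move=> b /=; rewrite Upow_basis !Ulin_ext_basis /= UpowD.
Qed.

Definition Ulinear (X Y : finType) (f : chain X -> chain Y) : Prop :=
  forall m v, f (Upow m v) = Upow m (f v).

Lemma eq_on_vec (X Y : finType) (f g : {linear chain X -> chain Y}) :
    Ulinear f -> Ulinear g ->
  (forall x, f (vec x) = g (vec x)) -> forall v, f v = g v.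
Proof. by move=> fU gU eq_fg; apply: eq_on_basis => b; rewrite basisE fU gU eq_fg. Qed.

Lemma Ulin_ext_comp (X Y Z : finType) (h : X -> chain Y) (h' : Y -> chain Z) v :
  Ulin_ext h' (Ulin_ext h v) = Ulin_ext (fun x => Ulin_ext h' (h x)) v.
Proof.
apply: (eq_on_vec (f := Ulin_ext h' \o Ulin_ext h) (g := Ulin_ext _)) => /=.
- by move=> m u /=; rewrite !Ulin_ext_Upow.
- by move=> m u /=; rewrite Ulin_ext_Upow.
by move=> x /=; rewrite !Ulin_ext_vec.
Qed.

Lemma eq_Ulin_ext (X Y : finType) (h h' : X -> chain Y) :
  h =1 h' -> Ulin_ext h =1 Ulin_ext h'.
Proof.
move=> eq_h; apply: (eq_on_vec (f := Ulin_ext h) (g := Ulin_ext h')).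
- exact: Ulin_ext_Upow.
- exact: Ulin_ext_Upow.
by move=> x /=; rewrite !Ulin_ext_vec.
Qed.

Lemma Ulin_ext_id (X : finType) v : Ulin_ext (@vec X) v = v.
Proof.
apply: (eq_on_vec (f := Ulin_ext (@vec X)) (g := idfun)) => //=.
  exact: Ulin_ext_Upow.
by move=> x /=; rewrite !Ulin_ext_vec.
Qed.

Lemma chain_addvv (X : finType) (v : chain X) : v + v = 0.
Proof. by rewrite -mulr2n -scaler_nat pchar_Zp ?scale0r. Qed.

(** * Degrees and filtration levels *)

(** The three support conditions on chains, on degree and on either level, are
    instances of this one, and are thus propagated by the same lemmas. *)
Definition supported (X : finType) (P : X * int -> Prop) (v : chain X) : Prop :=
  forall b, b \in msupp v -> P b.

Lemma supported0 (X : finType) P : supported P (0 : chain X).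
Proof. by move=> b; rewrite msupp0. Qed.

Lemma supportedD (X : finType) P (u v : chain X) :
  supported P u -> supported P v -> supported P (u + v).
Proof.
by move=> uP vP b /(fsubsetP (msuppD_le _ _)); rewrite inE => /orP[/uP|/vP].
Qed.

Lemma supportedZ (X : finType) P c (v : chain X) :
  supported P v -> supported P (c *: v).
Proof. by move=> vP b /(fsubsetP (msuppZ_le _ _)) /vP. Qed.

Lemma supported_basis (X : finType) (P : X * int -> Prop) b :
  P b -> supported P (<< b >> : chain X).
Proof. by move=> Pb c; rewrite msupp_basis inE => /eqP->. Qed.

Lemma supported_lin_ext (X Y : finType) (P : X * int -> Prop) (Q : Y * int -> Prop)
    (h : X * int -> chain Y) :
  (forall b, P b -> supported Q (h b)) ->
  forall v, supported P v -> supported Q (lin_ext h v).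
Proof.
move=> hQ v vP; rewrite lin_extE big_seq.
apply: (big_ind (@supported Y Q)) => [|u w|b /vP Pb]; first exact: supported0.
  exact: supportedD.
by apply: supportedZ; apply: hQ Pb.
Qed.

Definition within (A : bifiltered) (g l1 l2 : int) (v : chain (gen A)) : Prop :=
  [/\ homogeneous g v, in_filt1 l1 v & in_filt2 l2 v].

Lemma within0 (A : bifiltered) g l1 l2 : within g l1 l2 (0 : chain (gen A)).
Proof. by split; apply: supported0. Qed.

Lemma withinD (A : bifiltered) g l1 l2 (u v : chain (gen A)) :
  within g l1 l2 u -> within g l1 l2 v -> within g l1 l2 (u + v).
Proof. by case=> u0 u1 u2 [v0 v1 v2]; split; apply: supportedD. Qed.

Lemma within_vec (A : bifiltered) g l1 l2 (x : gen A) :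
  deg x = g -> lev1 x <= l1 -> lev2 x <= l2 -> within g l1 l2 (vec x).
Proof.
move=> dx x1 x2; split; apply: supported_basis.
- by rewrite /basis_deg mul0rn subr0.
- by rewrite /basis_lev1 subr0.
- by rewrite /basis_lev2 subr0.
Qed.

(** U lowers degrees and levels by fixed amounts, so the conditions on a
    U-linear map need only be tested on the generators. *)
Lemma bifiltered_map_gens (A B : bifiltered) (r : int) (h : gen A -> chain (gen B)) :
  (forall x, within (deg x + r) (lev1 x) (lev2 x) (h x)) ->
  bifiltered_map r (Ulin_ext h).
Proof.
move=> hP; split=> [v|g v|i v|i v]; first exact: Ulin_ext_Upow.
- apply: supported_lin_ext => -[x m] xm; apply: supported_lin_ext; first last.
    by case: (hP x) => deg_hx _ _; apply: deg_hx.
  move=> -[y n] yn; apply: supported_basis; move: xm yn.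
  by rewrite /basis_deg /=; lia.
- apply: supported_lin_ext => -[x m] xm; apply: supported_lin_ext; first last.
    by case: (hP x) => _ lev_hx _; apply: lev_hx.
  move=> -[y n] yn; apply: supported_basis; move: xm yn.
  by rewrite /basis_lev1 /=; lia.
- apply: supported_lin_ext => -[x m] xm; apply: supported_lin_ext; first last.
    by case: (hP x) => _ _ lev_hx; apply: lev_hx.
  move=> -[y n] yn; apply: supported_basis; move: xm yn.
  by rewrite /basis_lev2 /=; lia.
Qed.

(** * Deformation retracts *)

Lemma diff_vec (A : bifiltered) (x : gen A) : diff A (vec x) = bd x.
Proof. exact: Ulin_ext_vec. Qed.

Lemma diff_Upow (A : bifiltered) : Ulinear (diff A).
Proof. by move=> m v; apply: Ulin_ext_Upow. Qed.

(** Asking for [f \o g] to be the identity on the nose, rather than up to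
    homotopy, leaves a single homotopy to carry through compositions. *)
Definition deformation_retract (A B : bifiltered) : Prop :=
  exists (f : {linear chain (gen A) -> chain (gen B)})
         (g : {linear chain (gen B) -> chain (gen A)}),
    [/\ chain_map f, chain_map g, homotopic_to_id (g \o f) &
        forall v, f (g v) = v].

(** All the maps involved are U-linear, so each condition of a strict deformation
    retraction reduces to one on the generators. *)
Lemma deformation_retract_gens (A B : bifiltered) (f : gen A -> chain (gen B))
    (g : gen B -> chain (gen A)) (h : gen A -> chain (gen A)) :
    (forall x, within (deg x) (lev1 x) (lev2 x) (f x)) ->
    (forall t, within (deg t) (lev1 t) (lev2 t) (g t)) ->
    (forall x, within (deg x + 1) (lev1 x) (lev2 x) (h x)) ->
    (forall x, Ulin_ext f (bd x) = diff B (f x)) ->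
    (forall t, Ulin_ext g (bd t) = diff A (g t)) ->
    (forall t, Ulin_ext f (g t) = vec t) ->
    (forall x, Ulin_ext g (f x) = vec x + (diff A (h x) + Ulin_ext h (bd x))) ->
  deformation_retract A B.
Proof.
move=> f_lev g_lev h_lev fd gd fg gf; exists (Ulin_ext f), (Ulin_ext g); split.
- split; first by apply: bifiltered_map_gens => x; rewrite addr0.
  apply: (eq_on_vec (f := Ulin_ext f \o diff A) (g := diff B \o Ulin_ext f)) => /=.
  + by move=> m v /=; rewrite diff_Upow Ulin_ext_Upow.
  + by move=> m v /=; rewrite Ulin_ext_Upow diff_Upow.
  by move=> x; rewrite diff_vec Ulin_ext_vec fd.
- split; first by apply: bifiltered_map_gens => x; rewrite addr0.
  apply: (eq_on_vec (f := Ulin_ext g \o diff B) (g := diff A \o Ulin_ext g)) => /=.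
  + by move=> m v /=; rewrite diff_Upow Ulin_ext_Upow.
  + by move=> m v /=; rewrite Ulin_ext_Upow diff_Upow.
  by move=> x; rewrite diff_vec Ulin_ext_vec gd.
- exists (Ulin_ext h); split; first exact: bifiltered_map_gens.
  apply: (eq_on_vec (f := (Ulin_ext g \o Ulin_ext f) \- idfun)
    (g := (diff A \o Ulin_ext h) \+ (Ulin_ext h \o diff A))) => /=.
  + by move=> m v /=; rewrite !Ulin_ext_Upow linearB.
  + by move=> m v /=; rewrite diff_Upow !Ulin_ext_Upow diff_Upow linearD.
  by move=> x; rewrite diff_vec !Ulin_ext_vec gf addrC addKr.
- apply: (eq_on_vec (f := Ulin_ext f \o Ulin_ext g) (g := idfun)) => //=.
  + by move=> m v /=; rewrite !Ulin_ext_Upow.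
  by move=> t; rewrite Ulin_ext_vec fg.
Qed.

Lemma bifiltered_map_comp (A B C : bifiltered) r q
    (f : {linear chain (gen A) -> chain (gen B)})
    (g : {linear chain (gen B) -> chain (gen C)}) :
  bifiltered_map r f -> bifiltered_map q g -> bifiltered_map (r + q) (g \o f).
Proof.
case=> fU f0 f1 f2 [gU g0 g1 g2]; split=> [v|d v|i v|i v] /=.
- by rewrite fU gU.
- by move=> /f0 /g0; rewrite addrA.
- by move=> /f1 /g1.
- by move=> /f2 /g2.
Qed.

Lemma bifiltered_map_add (A B : bifiltered) r
    (f g : {linear chain (gen A) -> chain (gen B)}) :
  bifiltered_map r f -> bifiltered_map r g -> bifiltered_map r (f \+ g).
Proof.
case=> fU f0 f1 f2 [gU g0 g1 g2]; split=> [v|d v vd|i v vi|i v vi] /=.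
- by rewrite fU gU linearD.
- by apply: supportedD; [apply: f0 | apply: g0].
- by apply: supportedD; [apply: f1 | apply: g1].
- by apply: supportedD; [apply: f2 | apply: g2].
Qed.

Lemma chain_map_comp (A B C : bifiltered)
    (f : {linear chain (gen A) -> chain (gen B)})
    (g : {linear chain (gen B) -> chain (gen C)}) :
  chain_map f -> chain_map g -> chain_map (g \o f).
Proof.
case=> fb fd [gb gd]; split=> [|v /=]; last by rewrite fd gd.
exact: (bifiltered_map_comp fb gb).
Qed.

(** If [h] and [h'] are the two homotopies, then [h + g h' f] is one for the
    composite. *)
Lemma deformation_retract_trans (A B C : bifiltered) :
  deformation_retract A B -> deformation_retract B C -> deformation_retract A C.
Proof.
case=> f [g [fc gc [h [hb hE]] fg]] [f' [g' [f'c g'c [h' [h'b h'E]] fg']]].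
exists (f' \o f), (g \o g'); split; try exact: chain_map_comp.
  exists (h \+ (g \o (h' \o f))); split.
    apply: bifiltered_map_add => //.
    have [[fb _] [gb _]] := (fc, gc).
    by have := bifiltered_map_comp (bifiltered_map_comp fb h'b) gb; rewrite add0r addr0.
  move=> v /=; have [[_ fd] [_ gd]] := (fc, gc).
  have -> : g (g' (f' (f v))) - v = (g (f v) - v) + g (g' (f' (f v)) - f v).
    by rewrite linearB [RHS]addrC addrA subrK.
  by rewrite -[g (f v)]/((g \o f) v) hE (h'E (f v)) -fd !linearD /= gd addrACA.
by move=> v /=; rewrite fg fg'.
Qed.

Lemma deformation_retract_equivalent (A B : bifiltered) :
  deformation_retract A B -> homotopy_equivalent A B.
Proof.
case=> f [g [fc gc gf fg]]; exists f, g; split=> //.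
exists \0; split.
  split=> [v|d v _|i v _|i v _] /=; try exact: supported0.
  by rewrite linear0.
by move=> v /=; rewrite fg subrr linear0 addr0.
Qed.

(** * Isomorphisms given by a bijection of generators *)

Definition relabelling (A B : bifiltered) : Prop :=
  exists2 phi : gen A -> gen B, bijective phi &
    forall x, [/\ deg (phi x) = deg x, lev1 (phi x) = lev1 x,
                  lev2 (phi x) = lev2 x &
                  bd (phi x) = Ulin_ext (fun y => vec (phi y)) (bd x)].

Lemma relabelling_retract (A B : bifiltered) :
  relabelling A B -> deformation_retract A B.
Proof.
case=> phi [psi phiK psiK] compat.
apply: (@deformation_retract_gens _ _ (fun x => vec (phi x)) (fun t => vec (psi t))
  (fun=> 0)).
- by move=> x; have [dx x1 x2 _] := compat x; apply: within_vec; rewrite ?x1 ?x2.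
- move=> t; have [] := compat (psi t); rewrite psiK => dx x1 x2 _.
  by apply: within_vec; rewrite ?x1 ?x2.
- by move=> x; apply: within0.
- by move=> x; rewrite diff_vec; case: (compat x).
- move=> t; rewrite diff_vec; have [_ _ _] := compat (psi t); rewrite psiK => ->.
  rewrite Ulin_ext_comp -[RHS]Ulin_ext_id; apply: eq_Ulin_ext => x.
  by rewrite Ulin_ext_vec phiK.
- by move=> t; rewrite Ulin_ext_vec psiK.
move=> x; rewrite Ulin_ext_vec phiK linear0 add0r.
rewrite (_ : Ulin_ext _ _ = 0) ?addr0 //.
by rewrite /Ulin_ext lin_extE big1 // => b _; rewrite linear0 scaler0.
Qed.

Lemma relabelling_trans (A B C : bifiltered) :
  relabelling A B -> relabelling B C -> relabelling A C.
Proof.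
case=> phi phi_bij phiP [phi' phi'_bij phi'P].
exists (phi' \o phi) => [|x]; first exact: bij_comp.
have [-> -> -> ->] := phi'P (phi x); have [-> -> -> ->] := phiP x; split=> //.
by rewrite Ulin_ext_comp; apply: eq_Ulin_ext => y; rewrite Ulin_ext_vec.
Qed.

Lemma relabelling_dsum (A A' B B' : bifiltered) :
  relabelling A A' -> relabelling B B' -> relabelling (dsum A B) (dsum A' B').
Proof.
case=> phi [psi phiK psiK] phiP [phi' [psi' phi'K psi'K] phi'P].
exists (fun t : gen (dsum A B) =>
  match t with inl x => inl (phi x) | inr y => inr (phi' y) end).
  exists (fun t : gen (dsum A' B') =>
    match t with inl x => inl (psi x) | inr y => inr (psi' y) end).
    by case=> x; rewrite ?phiK ?phi'K.
  by case=> x; rewrite ?psiK ?psi'K.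
case=> x /=; [have [-> -> -> ->] := phiP x | have [-> -> -> ->] := phi'P x]; split=> //.
- rewrite [LHS]Ulin_ext_comp [RHS]Ulin_ext_comp.
  by apply: eq_Ulin_ext => y; rewrite !Ulin_ext_vec.
- rewrite [LHS]Ulin_ext_comp [RHS]Ulin_ext_comp.
  by apply: eq_Ulin_ext => y; rewrite !Ulin_ext_vec.
Qed.

Lemma relabelling_dsumC (A B : bifiltered) : relabelling (dsum A B) (dsum B A).
Proof.
exists (fun t : gen (dsum A B) => match t with inl x => inr x | inr y => inl y end).
  exists (fun t : gen (dsum B A) => match t with inl x => inr x | inr y => inl y end);
    by case.
by case=> x /=; split=> //; rewrite [RHS]Ulin_ext_comp; apply: eq_Ulin_ext => y;
  rewrite Ulin_ext_vec.
Qed.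

Lemma relabelling_dsumAC (A B C : bifiltered) :
  relabelling (dsum (dsum A B) C) (dsum (dsum A C) B).
Proof.
exists (fun t : gen (dsum (dsum A B) C) => match t return gen (dsum (dsum A C) B) with
  | inl (inl x) => inl (inl x) | inl (inr y) => inr y | inr z => inl (inr z) end).
  by exists (fun t : gen (dsum (dsum A C) B) => match t with
    | inl (inl x) => inl (inl x) | inl (inr z) => inr z | inr y => inl (inr y) end);
    case=> [[]|].
by case=> [[]|] x; split=> //=; rewrite /to_inl /to_inr !Ulin_ext_comp;
  apply: eq_Ulin_ext => y; rewrite !Ulin_ext_vec.
Qed.

(** * Staircases *)

(** The vertices at which arrows can start. By the same token, [active e i.+1] says
    that the step from x_i to x_(i+1) goes right. *)
Definition active (e : sign) (i : nat) : bool := odd i == is_positive e.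

Lemma activeS e i : active e i.+1 = ~~ active e i.
Proof. by rewrite /active /=; case: (odd i) (is_positive e) => -[]. Qed.

Lemma active_mirror e k i : (i <= k.*2)%N -> active e (k.*2 - i) = active e i.
Proof. by move=> le_i; rewrite /active oddB // odd_double. Qed.

(** The boundary formula is applied to many families indexed by [nat]: the
    vertices, their mirror images, and the images of these under linear maps.
    With the convention that a family vanishes beyond its last vertex, the two
    ends of a staircase need no separate treatment. *)
Definition neighbours (V : nmodType) (F : nat -> V) (i : nat) : V :=
  (if i is j.+1 then F j else 0) + F i.+1.

Definition zigzag (V : nmodType) (e : sign) (F : nat -> V) (i : nat) : V :=
  if active e i then neighbours F i else 0.

(** Consecutive vertices are never both active, so a zigzag only sees the
    inactive members of the family. This is what removes most of the
    correction terms at the middle vertex. *)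
Lemma eq_zigzag (V : nmodType) e (F G : nat -> V) i :
    (forall j, (j <= i.+1)%N -> ~~ active e j -> F j = G j) ->
  zigzag e F i = zigzag e G i.
Proof.
move=> eqFG; rewrite /zigzag; case: ifP => // act; rewrite /neighbours.
rewrite eqFG ?activeS ?act //; case: i act eqFG => [|i] //.
by rewrite activeS => act eqFG; rewrite eqFG //; lia.
Qed.

Lemma zigzagD (V : nmodType) e (F G : nat -> V) i :
  zigzag e (fun j => F j + G j) i = zigzag e F i + zigzag e G i.
Proof.
rewrite /zigzag; case: ifP => _; last by rewrite addr0.
by rewrite /neighbours addrACA; case: i => [|i]; rewrite ?addr0.
Qed.

Lemma map_zigzag (X : finType) (V : lmodType 'F_2) (f : {linear chain X -> V})
    e (F : nat -> chain X) i :
  f (zigzag e F i) = zigzag e (fun j => f (F j)) i.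
Proof.
rewrite /zigzag; case: ifP => _; last exact: linear0.
by rewrite /neighbours linearD; case: i => [|i]; rewrite ?linear0.
Qed.

Lemma zigzag_mirror (V : nmodType) e (F : nat -> V) k i :
    F k.*2.+1 = 0 -> (i <= k)%N -> (0 < k)%N ->
  zigzag e F (k.*2 - i) = zigzag e (fun j => F (k.*2 - j)%N) i.
Proof.
move=> F0 le_ik k_gt0; rewrite /zigzag active_mirror; last by lia.
case: ifP => // _; rewrite /neighbours.
have [m Em] : exists m, (k.*2 - i = m.+1)%N by exists (k.*2 - i).-1; lia.
rewrite Em addrC; congr (_ + _); last by congr F; lia.
case: i le_ik Em => [|i] le_ik Em; last by congr F; lia.
by rewrite -Em subn0.
Qed.

(** Total in [i], so that the vertices form a family to which [neighbours]
    applies also at the last vertex. *)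
Definition nvec (n i : nat) : chain 'I_n := \sum_(j < n | j == i :> nat) vec j.

Lemma nvec_ord n (i : 'I_n) : nvec n i = vec i.
Proof. by rewrite /nvec (big_pred1 i). Qed.

Lemma nvec_inord n i : (i <= n)%N -> nvec n.+1 i = vec (inord i).
Proof. by move=> le_in; rewrite -nvec_ord inordK. Qed.

Lemma nvec_out n i : (n <= i)%N -> nvec n i = 0.
Proof. by move=> le_ni; rewrite /nvec big1 // => j /eqP; case: j => /=; lia. Qed.

Lemma Ulin_ext_nvec n (Y : finType) (h : 'I_n.+1 -> chain Y) i (le_i : (i <= n)%N) :
  Ulin_ext h (nvec n.+1 i) = h (Ordinal (le_i : i < n.+1)%N).
Proof. by rewrite -Ulin_ext_vec -nvec_ord. Qed.

Lemma staircase_bd e b p g (i : gen (staircase e b p g)) :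
  bd i = zigzag e (nvec (size b).+1) i.
Proof.
rewrite /= /zigzag /active; case: ifP => // _; rewrite /neighbours.
case: i => -[|i] lt_i /=.
  by rewrite add0r; apply: eq_bigl => j; lia.
rewrite /nvec [X in _ = X + _]big_mkcond [X in _ = _ + X]big_mkcond /= -big_split /=.
rewrite big_mkcond; apply: eq_bigr => j _.
by rewrite eqSS; case: eqP => [->|_]; case: eqP; rewrite ?addr0 ?add0r //=; lia.
Qed.

Definition stair_deg (e : sign) (g : int) (i : nat) : int :=
  if odd i then (if e is Positive then g + 1 else g - 1) else g.

Lemma diff_staircase e b p g i : (i <= size b)%N ->
  diff (staircase e b p g) (nvec (size b).+1 i) = zigzag e (nvec (size b).+1) i.
Proof.
by move=> le_i; rewrite nvec_inord // diff_vec staircase_bd inordK.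
Qed.

Lemma vertexS_active e b p i : active e i.+1 ->
  vertex e b p i.+1 = ((vertex e b p i).1 + (nth 0%N b i)%:Z, (vertex e b p i).2).
Proof. by rewrite /active /= => ->. Qed.

Lemma vertexS_inactive e b p i : ~~ active e i.+1 ->
  vertex e b p i.+1 = ((vertex e b p i).1, (vertex e b p i).2 - (nth 0%N b i)%:Z).
Proof. by rewrite /active /= => /negbTE ->. Qed.

Lemma vertexE e b p i :
  vertex e b p i =
    (p.1 + \sum_(j < i | active e j.+1) (nth 0%N b j)%:Z,
     p.2 - \sum_(j < i | ~~ active e j.+1) (nth 0%N b j)%:Z).
Proof.
elim: i => [|i IHi]; first by rewrite !big_ord0 addr0 subr0; case: p.
have recr (P : pred nat) : \sum_(j < i.+1 | P j) (nth 0%N b j)%:Z =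
    \sum_(j < i | P j) (nth 0%N b j)%:Z + (if P i then (nth 0%N b i)%:Z else 0).
  by rewrite big_mkcond big_ord_recr -big_mkcond.
rewrite (recr (fun j => active e j.+1)) (recr (fun j => ~~ active e j.+1)).
have [act|act] := boolP (active e i.+1).
  by rewrite (vertexS_active _ _ act) IHi /= addr0 addrA.
by rewrite (vertexS_inactive _ _ act) IHi /= addr0 opprD addrA.
Qed.

Lemma eq_vertex e b b' p i :
  (forall j, (j < i)%N -> nth 0%N b j = nth 0%N b' j) -> vertex e b p i = vertex e b' p i.
Proof.
move=> eqb; rewrite !vertexE; congr (_ + _, _ - _);
  by apply: eq_bigr => j _; rewrite eqb.
Qed.

Lemma vertex_mono e b p i j : (i <= j)%N ->
  ((vertex e b p i).1 <= (vertex e b p j).1) &&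
  ((vertex e b p j).2 <= (vertex e b p i).2).
Proof.
elim: j => [|j IHj]; first by rewrite leqn0 => /eqP ->; rewrite !lexx.
rewrite leq_eqVlt => /predU1P[-> | /IHj /andP[le1 le2]]; first by rewrite !lexx.
have [act|act] := boolP (active e j.+1).
  by rewrite (vertexS_active _ _ act) /= le2 andbT; lia.
by rewrite (vertexS_inactive _ _ act) /= le1 /=; lia.
Qed.

Lemma stair_deg_neighbour e g i j :
  active e i -> ~~ active e j -> stair_deg e g j = stair_deg e g i - 1.
Proof.
rewrite /active /stair_deg; case: e => /=;
  by case: (odd i); case: (odd j) => //= _ _; lia.
Qed.

Lemma active_peak e b p i : active e i ->
  [/\ (vertex e b p i.-1).1 <= (vertex e b p i).1,
      (vertex e b p i.-1).2 <= (vertex e b p i).2,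
      (vertex e b p i.+1).1 <= (vertex e b p i).1 &
      (vertex e b p i.+1).2 <= (vertex e b p i).2].
Proof.
move=> act; rewrite [vertex e b p i.+1]vertexS_inactive ?activeS ?act //=.
case: i act => [|i] act /=; first by split; lia.
by have := vertexS_active b p act; rewrite /= => ->; split => /=; lia.
Qed.

Lemma within_nvec e b p g d l1 l2 i :
    stair_deg e g i = d -> (vertex e b p i).1 <= l1 -> (vertex e b p i).2 <= l2 ->
  within (A := staircase e b p g) d l1 l2 (nvec (size b).+1 i).
Proof.
move=> deg_i le1 le2; have [le_i | lt_i] := leqP i (size b); last first.
  by rewrite nvec_out //; apply: within0.
by rewrite nvec_inord //; apply: within_vec; rewrite /= inordK.
Qed.

Lemma staircase_complex e b p g : is_complex (staircase e b p g).
Proof.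
split.
  apply: bifiltered_map_gens => i; rewrite staircase_bd /zigzag.
  case: ifP => [act|_]; last exact: within0.
  have [le1 le2 le3 le4] := active_peak b p act.
  have act_i1 : ~~ active e i.+1 by rewrite activeS act.
  apply: withinD; last by apply: within_nvec => //; apply: stair_deg_neighbour.
  case: i act le1 le2 {le3 le4 act_i1} => -[|j] /= lt_j act le1 le2; first exact: within0.
  apply: within_nvec => //; apply: (@stair_deg_neighbour e g j.+1 j) => //.
  by move: act; rewrite activeS.
apply: (eq_on_vec (f := diff _ \o diff _) (g := \0)) => /=.
- by move=> m v /=; rewrite !diff_Upow.
- by move=> m v /=; rewrite linear0.
move=> i; rewrite diff_vec staircase_bd map_zigzag.
transitivity (zigzag e (fun=> 0 : chain 'I_(size b).+1) i); last first.
  by rewrite /zigzag /neighbours addr0; case: ifP => // _; case: (nat_of_ord i).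
apply: eq_zigzag => j _ /negbTE act_j; have [le_j | lt_j] := leqP j (size b); last first.
  by rewrite nvec_out // linear0.
by rewrite [LHS]diff_staircase // /zigzag act_j.
Qed.

(** * Acyclicity of staircases with an odd number of steps *)

(** The values of [t] at the inactive indices are partial sums of active
    members of [x], taken from the end at which the staircase with an odd
    number of steps has an active vertex: the last one if it is positive, the
    first one if it is negative. *)
Lemma zigzag_contraction (V : zmodType) e n (x : nat -> V) :
    (forall v : V, v + v = 0) -> odd n ->
  exists t : nat -> V, t n.+1 = 0 /\
    forall i, (i <= n)%N -> active e i -> neighbours t i = x i.
Proof.
move=> addvv odd_n; case: e.
  exists (fun j => \sum_(j <= i < n.+1 | odd i) x i); split; first by rewrite big_geq.
  case=> [|i] // le_i; rewrite /active eqb_id /= => odd_i; rewrite /neighbours.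
  rewrite big_ltn_cond ?(negbTE odd_i); last by lia.
  by rewrite big_ltn_cond /= ?odd_i -?addrA ?addvv ?addr0.
exists (fun j => if (j <= n)%N then \sum_(0 <= i < j | ~~ odd i) x i else 0).
rewrite ltnn; split=> // i le_i; rewrite /active eqbF_neg => act.
have lt_i : (i < n)%N.
  by move: le_i; rewrite leq_eqVlt => /predU1P[Ei | //]; rewrite Ei odd_n in act.
rewrite /neighbours lt_i; case: i {le_i} lt_i act => [|i] lt_i act.
  by rewrite add0r big_ltn_cond //= big_geq // addr0.
rewrite (_ : (i <= n)%N); last by lia.
rewrite big_mkcond [X in _ + X]big_mkcond /= !big_nat_recr //= act.
by move: act => /= /negbNE ->; rewrite addr0 addrA addvv add0r.
Qed.

(** The equations say that [u] takes the same value at consecutive inactive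
    indices; at the active end, where only one neighbour is left, this value
    is 0. *)
Lemma neighbours_eq0 (V : zmodType) e n (u : nat -> V) :
    odd n -> u n.+1 = 0 -> (forall i, (i <= n)%N -> active e i -> neighbours u i = 0) ->
  forall j, (j <= n)%N -> ~~ active e j -> u j = 0.
Proof.
move=> odd_n u_n u0; case: e u0 => u0 j le_j.
  rewrite /active eqb_id => act_j.
  have [m Em] : exists m, n = (j + m.*2.+1)%N.
    exists (n - j)./2; have := odd_double_half (n - j).
    by rewrite oddB // odd_n (negbTE act_j) /=; lia.
  elim: m j Em le_j act_j => [|m IHm] j Em le_j act_j.
    have := u0 j.+1; rewrite /active /= act_j /neighbours; rewrite addn1 in Em.
    by rewrite -Em u_n addr0; apply; rewrite ?leqnn.
  have := u0 j.+1; rewrite /active /= act_j /neighbours (IHm j.+2) ?addr0 //=; try by lia.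
  by apply=> //; lia.
rewrite /active eqbF_neg negbK => odd_j.
have [m Em] : exists m, j = m.*2.+1.
  by exists j./2; have := odd_double_half j; rewrite odd_j; lia.
rewrite {}Em {odd_j} in le_j *; elim: m le_j => [|m IHm] le_j.
  by have := u0 0%N; rewrite /neighbours add0r; apply.
have := u0 m.+1.*2; rewrite doubleS /neighbours IHm; last by lia.
by rewrite add0r; apply; rewrite /active /= ?odd_double //; lia.
Qed.

(** There are as many active vertices as inactive ones, and every inactive vertex
    is the boundary of a chain [t]. These chains define a contraction, which
    need not preserve the filtrations. *)
Lemma staircase_acyclic e b p g : odd (size b) -> acyclic (staircase e b p g).
Proof.
move=> odd_b; set n := size b in odd_b *; set x := nvec n.+1.
set d := diff (staircase e b p g).
have dx i : (i <= n)%N -> d (x i) = zigzag e x i by apply: diff_staircase.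
have [t [t_n t_act]] := zigzag_contraction e x (@chain_addvv _) odd_b.
(* Both sides solve the same recurrence, as the boundary is a zigzag. *)
have t_bd j : (j <= n)%N -> ~~ active e j -> d (t j) = x j.
  move=> le_j act_j; apply/eqP; rewrite -subr_eq0; apply/eqP.
  pose u i := d (t i) - x i; rewrite -/(u j).
  apply: (neighbours_eq0 (u := u) odd_b _ _ le_j act_j) => [|i le_i act_i].
    by rewrite /u /d t_n linear0 /x nvec_out // subrr.
  rewrite (_ : neighbours u i = d (neighbours t i) - neighbours x i).
    by rewrite t_act // dx // /zigzag act_i subrr.
  rewrite /u /neighbours; case: (i) => [|m]; rewrite ?add0r //.
  by rewrite /d linearD opprD addrACA.
pose h (i : gen (staircase e b p g)) : chain (gen (staircase e b p g)) :=
  if active e i then 0 else t i.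
have contract v : d (Ulin_ext h v) + Ulin_ext h (d v) = v.
  apply: (eq_on_vec (f := (diff (staircase e b p g) \o Ulin_ext h) \+
      (Ulin_ext h \o diff (staircase e b p g))) (g := idfun)) => //=.
    by move=> m w /=; rewrite diff_Upow !Ulin_ext_Upow diff_Upow linearD.
  move=> i; have le_i : (i <= n)%N by have := ltn_ord i.
  rewrite Ulin_ext_vec diff_vec staircase_bd map_zigzag -[RHS]nvec_ord.
  rewrite (@eq_zigzag _ _ _ t) => [|j le_ji act_j].
    rewrite /h /zigzag; case: ifP => act_i; last first.
      by rewrite addr0; apply: t_bd; rewrite ?act_i.
    by rewrite linear0 add0r t_act.
  have [le_j | lt_j] := leqP j n.
    by rewrite /= (Ulin_ext_nvec _ le_j) /h /= (negbTE act_j).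
  by rewrite nvec_out // linear0 (_ : j = n.+1) ?t_n //; lia.
by move=> v dv; exists (Ulin_ext h v); rewrite -[RHS]contract /d dv linear0 addr0.
Qed.

(** * Folded levels of a symmetric staircase *)

(** From the midpoint on, the staircase [a ++ rev a] retraces its first half
    with the coordinates exchanged: the steps are read backwards and, the total
    number of steps being even, horizontal and vertical ones are swapped. So it
    is symmetric as soon as its midpoint is on the diagonal. *)
Lemma vertex_mirror e (a : seq nat) p i :
    (vertex e a p (size a)).1 = (vertex e a p (size a)).2 -> (i <= size a)%N ->
  vertex e (a ++ rev a) p (size a + i) =
    ((vertex e a p (size a - i)).2, (vertex e a p (size a - i)).1).
Proof.
move=> diag; have front j : (j <= size a)%N ->
    vertex e (a ++ rev a) p j = vertex e a p j.
  by move=> le_j; apply: eq_vertex => m lt_m; rewrite nth_cat (leq_trans lt_m le_j).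
elim: i => [_ | i IHi lt_i].
  by rewrite addn0 subn0 front // [LHS]surjective_pairing {1}diag -diag.
have {IHi} := IHi (ltnW lt_i).
rewrite (_ : size a - i = (size a - i.+1).+1)%N; last by lia.
have nth_i : nth 0%N (a ++ rev a) (size a + i) = nth 0%N a (size a - i.+1).
  by rewrite nth_cat ltnNge leq_addr /= addKn nth_rev.
have parity : active e (size a + i).+1 = ~~ active e (size a - i.+1).+1.
  rewrite /active /= oddD oddB //=.
  by case: (odd _) (odd _) (is_positive e) => -[] [].
rewrite addnS; have [act|act] := boolP (active e (size a - i.+1).+1).
  rewrite (vertexS_active _ _ act) vertexS_inactive ?parity ?act // => -> /=.
  by rewrite nth_i addrK.
rewrite (vertexS_inactive _ _ act) vertexS_active ?parity ?act // => -> /=.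
by rewrite nth_i subrK.
Qed.

Definition fold_index (k i : nat) : nat := minn i (k.*2 - i).

Lemma vertex_fold e (a : seq nat) p i :
    (vertex e a p (size a)).1 = (vertex e a p (size a)).2 -> (i <= (size a).*2)%N ->
  let q := vertex e (a ++ rev a) p i in
  (Num.min q.1 q.2, Num.max q.1 q.2) = vertex e a p (fold_index (size a) i).
Proof.
move=> diag le_i /=.
have below j : (j <= size a)%N -> (vertex e a p j).1 <= (vertex e a p j).2.
  by move=> /(vertex_mono e a p) /andP[le1 le2]; lia.
have [le_ik | lt_ki] := leqP i (size a).
  rewrite (@eq_vertex e (a ++ rev a) a p i); last first.
    by move=> m lt_m; rewrite nth_cat (leq_trans lt_m le_ik).
  rewrite (min_l (below _ le_ik)) (max_r (below _ le_ik)) -surjective_pairing.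
  by congr vertex; rewrite /fold_index; lia.
rewrite (_ : i = size a + (i - size a))%N; last by lia.
rewrite vertex_mirror //; last by lia.
rewrite /= min_r ?max_l ?below //; try by lia.
by rewrite -surjective_pairing; congr vertex; rewrite /fold_index; lia.
Qed.

(** * Staircases with the last arrow removed *)

(** Half of a symmetric staircase, as the folding of the involutive complex
    leaves it: [c] tells whether the arrow between the last two vertices is
    lost. *)
Definition cut_staircase (e : sign) (c : bool) (a : seq nat) (p : int * int) (g : int) :
    bifiltered := {|
  gen := 'I_(size a).+1;
  deg := fun i => stair_deg e g i;
  lev1 := fun i => (vertex e a p i).1;
  lev2 := fun i => (vertex e a p i).2;
  bd := fun i =>
    if c && (i == size a :> nat) then 0
    else zigzag e (fun j => if c && (j == size a) then 0 else nvec (size a).+1 j) i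
|}.

Lemma cut_staircase_false e a p g :
  relabelling (cut_staircase e false a p g) (staircase e a p g).
Proof.
exists id => [|i]; first by exists id.
by split=> //; rewrite Ulin_ext_id staircase_bd.
Qed.

Lemma cut_staircase_true e a p g : (0 < size a)%N ->
  relabelling (cut_staircase e true a p g)
    (dsum (single_vertex (vertex e a p (size a)) (stair_deg e g (size a)))
          (staircase e (take (size a).-1 a) p g)).
Proof.
move=> a_gt0; have size_b : size (take (size a).-1 a) = (size a).-1.
  by rewrite size_takel // leq_pred.
set b := take _ a in size_b *.
exists (fun i : 'I_(size a).+1 =>
  if (i < size a)%N then inr (inord i : 'I_(size b).+1) else inl tt).
  exists (fun t : unit + 'I_(size b).+1 => if t is inr j then inord j else ord_max).
    move=> i; case: ifP => lt_i; apply: val_inj; rewrite /= ?inordK //; try by lia.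
    by have := ltn_ord i; lia.
  case=> [[]|j]; first by rewrite ltnn.
  have lt_j : (j < size a)%N by have := ltn_ord j; lia.
  by rewrite inordK ?lt_j ?inord_val //; lia.
move=> i; have le_i := ltn_ord i; case: ifP => lt_i; last first.
  have i_max : i = size a :> nat by lia.
  by rewrite /= i_max eqxx; split; rewrite ?linear0.
have lt_j : (i < (size b).+1)%N by lia.
have eq_lev j : (j <= (size a).-1)%N -> vertex e b p j = vertex e a p j.
  by move=> le_j; apply: eq_vertex => m lt_m; rewrite nth_take //; lia.
have bd_i : bd (inord i : gen (staircase e b p g)) = zigzag e (nvec (size b).+1) i.
  by rewrite staircase_bd inordK.
split; try by rewrite /= inordK // ?eq_lev; lia.
rewrite [LHS](congr1 (@to_inr unit _) bd_i) /=.
rewrite (_ : (i == size a :> nat) = false); last by lia.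
rewrite /to_inr !map_zigzag; apply: eq_zigzag => j le_ji _.
have [lt_ja | le_aj] := ltnP j (size a); last first.
  by rewrite (_ : j == size a) ?nvec_out ?linear0 //; lia.
have le_jb : (j <= size b)%N by lia.
rewrite (_ : (j == size a) = false) /=; last by lia.
rewrite (Ulin_ext_nvec _ le_jb) (Ulin_ext_nvec _ (ltnW lt_ja)) /= lt_ja.
by congr (vec (inr _)); apply: val_inj; rewrite /= inordK.
Qed.

(** * Folding the involutive complex *)

Lemma Ulin_ext_inl (X X' Y : finType) (f : X -> chain Y) (f' : X' -> chain Y) v :
  Ulin_ext (sum_case f f') (to_inl X' v) = Ulin_ext f v.
Proof. by rewrite Ulin_ext_comp; apply: eq_Ulin_ext => x; rewrite Ulin_ext_vec. Qed.

Lemma Ulin_ext_inr (X X' Y : finType) (f : X -> chain Y) (f' : X' -> chain Y) v :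
  Ulin_ext (sum_case f f') (to_inr X v) = Ulin_ext f' v.
Proof. by rewrite Ulin_ext_comp; apply: eq_Ulin_ext => x; rewrite Ulin_ext_vec. Qed.

Section Folding.
Variables (e : sign) (a : seq nat) (p : int * int) (g : int).
Hypothesis a_gt0 : (0 < size a)%N.
Hypothesis diag : (vertex e a p (size a)).1 = (vertex e a p (size a)).2.

(* The number of steps of C is [k.*2], but its vertices are indexed by a type
   that mentions [N]. *)
Local Notation k := (size a).
Local Notation N := (size (a ++ rev a)).
Local Notation cone :=
  (@involutive_complex (staircase e (a ++ rev a) p g) (@rev_ord _)).
Local Notation halves :=
  (dsum (cut_staircase e (~~ active e k) a p (g + 1))
        (cut_staircase e (active e k) a p g)).

Definition cone_y i : chain (gen cone) := to_inl _ (nvec N.+1 i).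
Definition cone_z i : chain (gen cone) := to_inr _ (nvec N.+1 i).
Definition half_y i : chain (gen halves) := to_inl _ (nvec k.+1 i).
Definition half_z i : chain (gen halves) := to_inr _ (nvec k.+1 i).

Local Notation y := cone_y.
Local Notation z := cone_z.
Local Notation Y := half_y.
Local Notation Z := half_z.

Lemma size_symmetric_steps : N = k.*2.
Proof. by rewrite size_cat size_rev addnn. Qed.

Lemma cone_y_out : y k.*2.+1 = 0.
Proof. by rewrite /y nvec_out ?linear0 // size_symmetric_steps. Qed.

Lemma cone_z_out : z k.*2.+1 = 0.
Proof. by rewrite /z nvec_out ?linear0 // size_symmetric_steps. Qed.

Lemma diff_y i : (i <= k.*2)%N ->
  diff cone (y i) = zigzag e y i + (z (k.*2 - i) + z i).
Proof.
move=> le_i; have le_iN : (i <= N)%N by rewrite size_symmetric_steps.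
rewrite /y /diff [LHS]Ulin_ext_inl (Ulin_ext_nvec _ le_iN) staircase_bd map_zigzag.
congr (_ + _); rewrite linearD; congr (_ + _).
  have -> : rev_ord (Ordinal (le_iN : i < N.+1)%N) =
      Ordinal (leq_subr i N : N - i < N.+1)%N by apply: val_inj.
  by rewrite -(nvec_ord (Ordinal (leq_subr i N : N - i < N.+1)%N)) -size_symmetric_steps.
by rewrite -(nvec_ord (Ordinal (le_iN : i < N.+1)%N)).
Qed.

Lemma diff_z i : (i <= k.*2)%N -> diff cone (z i) = zigzag e z i.
Proof.
move=> le_i; have le_iN : (i <= N)%N by rewrite size_symmetric_steps.
by rewrite /z /diff [LHS]Ulin_ext_inr (Ulin_ext_nvec _ le_iN) staircase_bd map_zigzag.
Qed.

(** The first half can only lose an arrow from x_(k-1) to x_k, and the second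
    half one from x_k to x_(k-1). In this form the boundaries of the halves do
    not depend on whether x_k is active. *)
Lemma diff_half_y i : (i <= k)%N ->
  diff halves (Y i) = zigzag e (fun j => if (j < k)%N then Y j else 0) i.
Proof.
move=> le_i; rewrite /Y /diff [LHS]Ulin_ext_inl (Ulin_ext_nvec _ le_i) /=.
case: ifP => [/andP[act_k /eqP ->] | cut_i].
  by rewrite linear0 /zigzag (negbTE act_k).
rewrite map_zigzag; apply: eq_zigzag => j le_j act_j.
have [Ej | ne_jk] := eqVneq j k; last first.
  by rewrite andbF; case: ifP => // lt_j; rewrite nvec_out ?linear0 //; lia.
by rewrite -Ej ltnn act_j linear0.
Qed.

Lemma diff_half_z i : (i <= k)%N ->
  diff halves (Z i) = if (i < k)%N then zigzag e Z i else 0.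
Proof.
move=> le_i; rewrite /Z /diff [LHS]Ulin_ext_inr (Ulin_ext_nvec _ le_i) /=.
have [lt_i | le_ki] := ltnP i k; last first.
  have -> : i = k by lia.
  rewrite eqxx andbT; case: ifP => [|act_k]; first by rewrite linear0.
  by rewrite /zigzag act_k linear0.
rewrite (_ : (i == k) = false) ?andbF; last by lia.
rewrite map_zigzag; apply: eq_zigzag => j le_j act_j.
by have [Ej|_] := eqVneq j k; rewrite ?andbF //; move: act_j; rewrite Ej => /negbTE ->.
Qed.

(** The quotient by the subcomplex spanned by the y_i, i < k, and their
    boundaries. Modulo these, z_(2k-i) is z_i plus the copy of the boundary of
    x_i in C[1], of which only y_k survives, when i = k - 1 and x_i is active. *)
Definition fold_map : gen cone -> chain (gen halves) :=
  sum_case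
    (fun i : 'I_N.+1 => if (i < k)%N then 0 else Y (k.*2 - i))
    (fun i : 'I_N.+1 => if (i <= k)%N then Z i else
       Z (k.*2 - i) + (if (i == k.+1 :> nat) && ~~ active e k then Y k else 0)).

(** If x_k is active then z_k is not a cycle, but z_k + y_(k-1) is. *)
Definition unfold_map : gen halves -> chain (gen cone) :=
  sum_case
    (fun i : 'I_k.+1 => if (i < k)%N then y i + y (k.*2 - i) else y k)
    (fun i : 'I_k.+1 =>
       z i + (if (i == k :> nat) && active e k then y k.-1 else 0)).

(** The inverse of the cancelled component y_i -> z_i + z_(2k-i). *)
Definition fold_homotopy : gen cone -> chain (gen cone) :=
  sum_case
    (fun=> 0)
    (fun i : 'I_N.+1 => if (k < i)%N then y (k.*2 - i) else 0).

Local Notation F := (Ulin_ext fold_map).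
Local Notation G := (Ulin_ext unfold_map).
Local Notation H := (Ulin_ext fold_homotopy).

Lemma fold_y i : (i <= k.*2)%N -> F (y i) = if (i < k)%N then 0 else Y (k.*2 - i).
Proof.
move=> le_i; have le_iN : (i <= N)%N by rewrite size_symmetric_steps.
by rewrite [LHS]Ulin_ext_inl (Ulin_ext_nvec _ le_iN).
Qed.

Lemma fold_z i : (i <= k)%N -> F (z i) = Z i.
Proof.
move=> le_i; have le_iN : (i <= N)%N by rewrite size_symmetric_steps; lia.
by rewrite [LHS]Ulin_ext_inr (Ulin_ext_nvec _ le_iN) /= le_i.
Qed.

Lemma fold_z_mirror i : (i < k)%N ->
  F (z (k.*2 - i)) = Z i + (if (i.+1 == k) && ~~ active e k then Y k else 0).
Proof.
move=> lt_i; have le_iN : (k.*2 - i <= N)%N by rewrite size_symmetric_steps; lia.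
rewrite [LHS]Ulin_ext_inr (Ulin_ext_nvec _ le_iN) /= ifF; last by lia.
by congr (Z _ + (if _ && _ then _ else _)); lia.
Qed.

Lemma unfold_y i : (i <= k)%N ->
  G (Y i) = if (i < k)%N then y i + y (k.*2 - i) else y k.
Proof. by move=> le_i; rewrite [LHS]Ulin_ext_inl (Ulin_ext_nvec _ le_i). Qed.

Lemma unfold_z i : (i <= k)%N ->
  G (Z i) = z i + (if (i == k) && active e k then y k.-1 else 0).
Proof. by move=> le_i; rewrite [LHS]Ulin_ext_inr (Ulin_ext_nvec _ le_i). Qed.

Lemma homotopy_y i : H (y i) = 0.
Proof.
rewrite [LHS]Ulin_ext_inl; have [le_i | lt_i] := leqP i N.
  by rewrite (Ulin_ext_nvec _ le_i).
by rewrite nvec_out ?linear0.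
Qed.

Lemma homotopy_z i : (i <= k.*2)%N ->
  H (z i) = if (k < i)%N then y (k.*2 - i) else 0.
Proof.
move=> le_i; have le_iN : (i <= N)%N by rewrite size_symmetric_steps.
by rewrite [LHS]Ulin_ext_inr (Ulin_ext_nvec _ le_iN).
Qed.

Lemma zigzag_at_k (V : zmodType) (X : nat -> V) :
  zigzag e X k = if active e k then X k.-1 + X k.+1 else 0.
Proof. by rewrite /zigzag /neighbours; case: (k) a_gt0. Qed.

Lemma mirror_pred : (k.*2 - k.-1 = k.+1)%N. Proof. lia. Qed.
Lemma mirror_k : (k.*2 - k = k)%N. Proof. lia. Qed.

Lemma zigzag_peak (V : nmodType) (v : V) i : (i < k)%N ->
  zigzag e (fun j => if j == k then v else 0) i =
    if (i.+1 == k) && ~~ active e k then v else 0.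
Proof.
move=> lt_i; rewrite /zigzag /neighbours.
rewrite (_ : (if i is j.+1 then _ else 0) = 0); last first.
  by case: i lt_i => [|i] lt_i //; case: eqP => //; lia.
rewrite add0r; have [Ei | _] := eqVneq i.+1 k; last by rewrite if_same.
by have -> : active e i = ~~ active e k by rewrite -Ei activeS negbK.
Qed.

(** The folded image of the part of the boundary of y_i that lies in C[1]. It is
    the correction term in the value of [fold_map] at z_(2k-i), which makes the
    whole boundary of y_i fold to 0. *)
Lemma zigzag_fold_y i : (i < k)%N ->
  zigzag e (fun j => F (y j)) i = if (i.+1 == k) && ~~ active e k then Y k else 0.
Proof.
move=> lt_i; rewrite -zigzag_peak //; apply: eq_zigzag => j le_j _.
rewrite fold_y; last by lia.
by have [->|ne_j] := eqVneq j k; rewrite ?ltnn ?mirror_k //; case: ifP => //; lia.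
Qed.

Lemma cone_gens (P : nat -> Prop) :
    (forall i, (i < k)%N -> P i) -> P k -> (forall i, (i < k)%N -> P (k.*2 - i)%N) ->
  forall i, (i <= k.*2)%N -> P i.
Proof.
move=> lo mid hi i le_i; have [lt_i | lt_i | Ei] := ltngtP i k; first exact: lo.
  by rewrite (_ : i = k.*2 - (k.*2 - i))%N; [apply: hi | ]; lia.
by rewrite Ei.
Qed.

Lemma fold_y_lo i : (i < k)%N -> F (y i) = 0.
Proof. by move=> lt_i; rewrite fold_y ?lt_i //; lia. Qed.

Lemma fold_y_mirror i : (i <= k)%N -> F (y (k.*2 - i)) = Y i.
Proof.
move=> lt_i; rewrite fold_y; last by lia.
by rewrite ifF; [congr (Y _) | ]; lia.
Qed.

(** For i < k this is the choice of the correction term. The case of y_(2k-i)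
    follows, as its boundary has the same component in C as that of y_i. *)
Lemma fold_chain_y i : (i <= k.*2)%N -> F (diff cone (y i)) = diff halves (F (y i)).
Proof.
move: i; apply: cone_gens => [i lt_i||i lt_i].
- rewrite fold_y_lo // linear0 diff_y; last by lia.
  rewrite !linearD /= map_zigzag zigzag_fold_y // fold_z_mirror // fold_z; last by lia.
  by rewrite [Z i + _]addrC -addrA chain_addvv addr0 chain_addvv.
- rewrite fold_y ?ltnn ?mirror_k; last by lia.
  rewrite diff_y; last by lia.
  rewrite mirror_k chain_addvv addr0 map_zigzag diff_half_y // !zigzag_at_k /=.
  rewrite (_ : (k.+1 < k)%N = false); last by lia.
  rewrite fold_y_lo ?ltn_predL // add0r addr0 a_gt0.
  by have := fold_y_mirror (leq_pred k); rewrite mirror_pred => ->.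
rewrite fold_y_mirror ?(ltnW lt_i) // diff_y ?leq_subr // !linearD /= map_zigzag.
rewrite zigzag_mirror ?cone_y_out ?linear0 ?(ltnW lt_i) //.
rewrite subKn ?fold_z_mirror ?fold_z; try by lia.
rewrite [Z i + (Z i + _)]addrA chain_addvv add0r diff_half_y; last by lia.
rewrite -zigzag_fold_y // -zigzagD; apply: eq_zigzag => j le_j _.
have le_jk : (j <= k)%N by lia.
rewrite /= fold_y_mirror // fold_y; last by lia.
case: ifP => [_|ge_j]; first by rewrite addr0.
have -> : j = k by lia.
by rewrite mirror_k chain_addvv.
Qed.

Lemma fold_chain_z i : (i <= k.*2)%N -> F (diff cone (z i)) = diff halves (F (z i)).
Proof.
move: i; apply: cone_gens => [i lt_i||i lt_i].
- rewrite fold_z ?(ltnW lt_i) // diff_z; last by lia.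
  rewrite map_zigzag diff_half_z ?(ltnW lt_i) // lt_i; apply: eq_zigzag => j le_j _.
  by rewrite /= fold_z //; lia.
- rewrite fold_z // diff_z; last by lia.
  rewrite map_zigzag diff_half_z // ltnn zigzag_at_k; case: ifP => // act_k.
  have Fz : F (z k.+1) = Z k.-1.
    have lt_pred : (k.-1 < k)%N by rewrite ltn_predL.
    by have := fold_z_mirror lt_pred; rewrite mirror_pred act_k andbF addr0.
  by rewrite /= fold_z ?leq_pred // Fz chain_addvv.
rewrite fold_z_mirror // diff_z ?leq_subr // map_zigzag linearD /=.
rewrite zigzag_mirror ?cone_z_out ?linear0 ?(ltnW lt_i) //.
rewrite diff_half_z ?(ltnW lt_i) // lt_i.
rewrite [X in _ = _ + X](_ : _ = 0) ?addr0; last first.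
  case: ifP => [/andP[_ act_k]|_]; last exact: linear0.
  by rewrite diff_half_y // /zigzag (negbTE act_k).
apply: eq_zigzag => j le_j act_j; have [lt_j | ge_j] := ltnP j k.
  rewrite /= fold_z_mirror //; case: eqP => [Ej | _]; last by rewrite addr0.
  have -> : active e k by rewrite -Ej activeS.
  by rewrite addr0.
have -> : j = k by lia.
by rewrite /= mirror_k fold_z.
Qed.

Lemma unfold_chain_y i : (i <= k)%N -> G (diff halves (Y i)) = diff cone (G (Y i)).
Proof.
move=> le_i; rewrite diff_half_y // unfold_y // map_zigzag.
have [lt_i | ge_i] := ltnP i k.
  rewrite linearD /= !diff_y ?leq_subr //; last by lia.
  rewrite zigzag_mirror ?cone_y_out // subKn; last by lia.
  rewrite addrACA -zigzagD [z i + _]addrC chain_addvv addr0.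
  apply: eq_zigzag => j le_j _; have [lt_j | ge_j] := ltnP j k.
    by rewrite /= unfold_y ?(ltnW lt_j) // lt_j.
  have -> : j = k by lia.
  by rewrite /= linear0 mirror_k chain_addvv.
have -> : i = k by lia.
rewrite diff_y; last by lia.
rewrite mirror_k chain_addvv addr0 !zigzag_at_k /=.
rewrite (_ : (k.+1 < k)%N = false); last by lia.
rewrite ltn_predL a_gt0 linear0 addr0 unfold_y ?leq_pred //.
by rewrite ltn_predL a_gt0 mirror_pred.
Qed.

Lemma unfold_chain_z i : (i <= k)%N -> G (diff halves (Z i)) = diff cone (G (Z i)).
Proof.
move=> le_i; rewrite diff_half_z // unfold_z //.
have [lt_i | ge_i] := ltnP i k.
  rewrite (_ : (i == k) = false) ?addr0; last by lia.
  rewrite diff_z; last by lia.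
  rewrite map_zigzag; apply: eq_zigzag => j le_j act_j.
  rewrite /= unfold_z; last by lia.
  by have [Ej|_] := eqVneq j k; rewrite ?addr0 // -Ej (negbTE act_j) addr0.
have -> : i = k by lia.
rewrite eqxx linear0 linearD /= diff_z; last by lia.
rewrite zigzag_at_k; case: ifP => act_k; last by rewrite linear0 addr0.
rewrite diff_y; last by lia.
rewrite /zigzag ifF; last by move: act_k; rewrite -{1}(prednK a_gt0) activeS => /negbTE.
by rewrite mirror_pred add0r [z k.+1 + _]addrC chain_addvv.
Qed.

Lemma unfoldK_y i : (i <= k)%N -> F (G (Y i)) = Y i.
Proof.
move=> le_i; rewrite unfold_y //; case: ifP => lt_i.
  by rewrite linearD /= fold_y_lo // fold_y_mirror // add0r.
have -> : i = k by lia.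
by have := fold_y_mirror (leqnn k); rewrite mirror_k.
Qed.

Lemma unfoldK_z i : (i <= k)%N -> F (G (Z i)) = Z i.
Proof.
move=> le_i; rewrite unfold_z // linearD /= fold_z //.
by case: ifP; rewrite ?linear0 ?addr0 // fold_y_lo ?addr0 // ltn_predL.
Qed.

Lemma foldK_y i : (i <= k.*2)%N ->
  G (F (y i)) = y i + (diff cone (H (y i)) + H (diff cone (y i))).
Proof.
move=> le_i; rewrite homotopy_y linear0 add0r diff_y // !linearD /= map_zigzag.
rewrite [zigzag _ _ _](_ : _ = 0) ?add0r; last first.
  transitivity (zigzag e (fun=> 0 : chain (gen cone)) i).
    by apply: eq_zigzag => j _ _; apply: homotopy_y.
  by rewrite /zigzag /neighbours addr0; case: ifP => // _; case: (i).
move: i le_i; apply: cone_gens => [i lt_i||i lt_i].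
- rewrite fold_y_lo // linear0 !homotopy_z; try by lia.
  rewrite ifT ?subKn ?ifF; try by lia.
  by rewrite addr0 chain_addvv.
- have := fold_y_mirror (leqnn k); rewrite mirror_k => ->.
  by rewrite chain_addvv addr0 unfold_y // ltnn.
rewrite fold_y_mirror ?(ltnW lt_i) // unfold_y ?(ltnW lt_i) // lt_i.
rewrite !homotopy_z ?subKn; try by lia.
rewrite ifF ?ifT; try by lia.
by rewrite add0r addrC.
Qed.

(** At z_(2k-i) both sides involve z_i and the part of the boundary of y_i that
    lies in C[1]; the homotopy at the boundary of z_(2k-i) removes from the
    latter everything but y_k. *)
Lemma foldK_z i : (i <= k.*2)%N ->
  G (F (z i)) = z i + (diff cone (H (z i)) + H (diff cone (z i))).
Proof.
move: i; apply: cone_gens => [i lt_i||i lt_i].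
- rewrite fold_z ?(ltnW lt_i) // unfold_z ?(ltnW lt_i) // ifF; last by lia.
  rewrite homotopy_z ?ifF ?linear0 ?add0r ?diff_z; try by lia.
  congr (_ + _); rewrite map_zigzag.
  transitivity (zigzag e (fun=> 0 : chain (gen cone)) i).
    by rewrite /zigzag /neighbours addr0; case: ifP => // _; case: (i).
  by apply: eq_zigzag => j le_j _; rewrite /= homotopy_z ?ifF //; lia.
- rewrite fold_z // unfold_z // eqxx homotopy_z ?ltnn ?linear0 ?add0r ?diff_z; try by lia.
  congr (_ + _); rewrite map_zigzag zigzag_at_k /=; case: ifP => // _.
  rewrite !homotopy_z; try by lia.
  rewrite ifF ?ifT ?add0r; try by lia.
  by congr (y _); lia.
rewrite fold_z_mirror // homotopy_z ?leq_subr //.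
rewrite (_ : (k < k.*2 - i)%N); last by lia.
rewrite subKn; last by lia.
rewrite diff_z ?leq_subr // zigzag_mirror ?cone_z_out // ?(ltnW lt_i) //.
rewrite diff_y; last by lia.
rewrite map_zigzag linearD /= unfold_z ?(ltnW lt_i) //.
rewrite (_ : (i == k) = false) ?addr0; last by lia.
have -> : G (if (i.+1 == k) && ~~ active e k then Y k else 0) =
    zigzag e y i + zigzag e (fun j => H (z (k.*2 - j))) i.
  rewrite -zigzagD (@eq_zigzag _ e _ (fun j => if j == k then y k else 0)); last first.
    move=> j le_j _; rewrite /= homotopy_z ?leq_subr //; have [-> | ne_j] := eqVneq j k.
      by rewrite mirror_k ltnn addr0.
    by rewrite ifT ?subKn ?chain_addvv //; lia.
  rewrite zigzag_peak //; case: ifP => _; last exact: linear0.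
  by rewrite unfold_y ?ltnn.
by rewrite [_ + (z _ + z _)]addrC -!addrA [RHS]addrA chain_addvv add0r.
Qed.

Local Notation L i := (vertex e a p (fold_index k i)).

Lemma cone_levels (i : 'I_N.+1) : let x := i : gen (staircase e (a ++ rev a) p g) in
  Num.min (lev1 x) (lev2 x) = (L i).1 /\ Num.max (lev1 x) (lev2 x) = (L i).2.
Proof.
have le_i : (i <= k.*2)%N by rewrite -size_symmetric_steps -ltnS.
by have := vertex_fold diag le_i; rewrite /= => <-.
Qed.

Lemma within_cone_y d l1 l2 i : (i <= k.*2)%N ->
    stair_deg e g i + 1 = d -> (L i).1 <= l1 -> (L i).2 <= l2 ->
  within (A := cone) d l1 l2 (y i).
Proof.
move=> le_i deg_i le1 le2; have lt_i : (i < N.+1)%N by rewrite size_symmetric_steps.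
have [lev1_i lev2_i] := cone_levels (Ordinal lt_i).
rewrite (_ : y i = vec (inl (Ordinal lt_i) : gen cone)).
  by apply: within_vec; rewrite /= ?[Num.min _ _]lev1_i ?[Num.max _ _]lev2_i.
exact: (Ulin_ext_nvec _ (lt_i : (i <= N)%N)).
Qed.

Lemma within_cone_z d l1 l2 i : (i <= k.*2)%N ->
    stair_deg e g i = d -> (L i).1 <= l1 -> (L i).2 <= l2 ->
  within (A := cone) d l1 l2 (z i).
Proof.
move=> le_i deg_i le1 le2; have lt_i : (i < N.+1)%N by rewrite size_symmetric_steps.
have [lev1_i lev2_i] := cone_levels (Ordinal lt_i).
rewrite (_ : z i = vec (inr (Ordinal lt_i) : gen cone)).
  by apply: within_vec; rewrite /= ?[Num.min _ _]lev1_i ?[Num.max _ _]lev2_i.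
exact: (Ulin_ext_nvec _ (lt_i : (i <= N)%N)).
Qed.

Lemma within_half_y d l1 l2 i : (i <= k)%N ->
    stair_deg e (g + 1) i = d ->
    (vertex e a p i).1 <= l1 -> (vertex e a p i).2 <= l2 ->
  within (A := halves) d l1 l2 (Y i).
Proof.
move=> le_i deg_i le1 le2.
rewrite (_ : Y i = vec (inl (Ordinal (le_i : i < k.+1)%N) : gen halves)).
  exact: within_vec.
exact: (Ulin_ext_nvec _ le_i).
Qed.

Lemma within_half_z d l1 l2 i : (i <= k)%N ->
    stair_deg e g i = d ->
    (vertex e a p i).1 <= l1 -> (vertex e a p i).2 <= l2 ->
  within (A := halves) d l1 l2 (Z i).
Proof.
move=> le_i deg_i le1 le2.
rewrite (_ : Z i = vec (inr (Ordinal (le_i : i < k.+1)%N) : gen halves)).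
  exact: within_vec.
exact: (Ulin_ext_nvec _ le_i).
Qed.

Lemma stair_degD (d : int) i : stair_deg e (g + d) i = stair_deg e g i + d.
Proof. by rewrite /stair_deg; case: ifP => //; case: (e) => _; lia. Qed.

Lemma stair_deg_mirror i : (i <= k.*2)%N -> stair_deg e g (k.*2 - i) = stair_deg e g i.
Proof. by move=> le_i; rewrite /stair_deg oddB // odd_double. Qed.

Lemma fold_index_mirror i : (i <= k.*2)%N -> fold_index k (k.*2 - i) = fold_index k i.
Proof. by rewrite /fold_index; lia. Qed.

Lemma fold_index_lo i : (i <= k)%N -> fold_index k i = i.
Proof. by rewrite /fold_index; lia. Qed.

Lemma cone_vec_y (i : 'I_N.+1) : vec (inl i : gen cone) = y i.
Proof. by rewrite /y nvec_ord [RHS]Ulin_ext_vec. Qed.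

Lemma cone_vec_z (i : 'I_N.+1) : vec (inr i : gen cone) = z i.
Proof. by rewrite /z nvec_ord [RHS]Ulin_ext_vec. Qed.

Lemma half_vec_y (i : 'I_k.+1) : vec (inl i : gen halves) = Y i.
Proof. by rewrite /Y nvec_ord [RHS]Ulin_ext_vec. Qed.

Lemma half_vec_z (i : 'I_k.+1) : vec (inr i : gen halves) = Z i.
Proof. by rewrite /Z nvec_ord [RHS]Ulin_ext_vec. Qed.

Lemma fold_map_within (x : gen cone) : within (deg x) (lev1 x) (lev2 x) (fold_map x).
Proof.
case: x => i; have [lev1_i lev2_i] := cone_levels i;
  have le_i : (i <= k.*2)%N by rewrite -size_symmetric_steps -ltnS.
all: rewrite /= ?[Num.min _ _]lev1_i ?[Num.max _ _]lev2_i.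
all: rewrite -/(stair_deg e g i).
- case: ifP => [_|ge_i]; first exact: within0.
  have fold_i : fold_index k i = (k.*2 - i)%N by rewrite /fold_index; lia.
  by apply: within_half_y; rewrite ?fold_i ?stair_degD ?stair_deg_mirror //; lia.
case: ifP => ge_i; first by apply: within_half_z; rewrite ?fold_index_lo.
have fold_i : fold_index k i = (k.*2 - i)%N by rewrite /fold_index; lia.
apply: withinD; first by apply: within_half_z; rewrite ?fold_i ?stair_deg_mirror //; lia.
case: ifP => [/andP[/eqP Ei act_k]|_]; last exact: within0.
have act_i : active e k.-1 by move: act_k; rewrite -{1}(prednK a_gt0) activeS negbK.
have [_ _] := active_peak a p act_i; rewrite (prednK a_gt0) => le1 le2.
have act_i' : active e i by rewrite Ei activeS.
apply: within_half_y => //.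
- by rewrite stair_degD (stair_deg_neighbour g act_i') // subrK.
- by rewrite fold_i Ei -mirror_pred subKn //; lia.
by rewrite fold_i Ei -mirror_pred subKn //; lia.
Qed.

Lemma unfold_map_within (t : gen halves) :
  within (deg t) (lev1 t) (lev2 t) (unfold_map t).
Proof.
case: t => i /=; have le_i : (i <= k)%N by rewrite -ltnS.
  have y_i : within (A := cone) (stair_deg e (g + 1) i) (vertex e a p i).1
      (vertex e a p i).2 (y i).
    by apply: within_cone_y; rewrite ?fold_index_lo ?stair_degD //; lia.
  case: ifP => [lt_i | ge_i]; last first.
    by move: y_i; rewrite (_ : (i : nat) = k) //; lia.
  apply: withinD => //; apply: within_cone_y;
    rewrite ?stair_deg_mirror ?stair_degD ?fold_index_mirror ?fold_index_lo //; lia.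
apply: withinD; first by apply: within_cone_z; rewrite ?fold_index_lo //; lia.
case: ifP => [/andP[/eqP -> act_k]|_]; last exact: within0.
have [le1 le2 _ _] := active_peak a p act_k.
have act_i : ~~ active e k.-1 by rewrite -activeS prednK.
apply: within_cone_y; rewrite ?fold_index_lo //; try by lia.
by rewrite (stair_deg_neighbour g act_k) // subrK.
Qed.

Lemma fold_homotopy_within (x : gen cone) :
  within (deg x + 1) (lev1 x) (lev2 x) (fold_homotopy x).
Proof.
case: x => i; have [lev1_i lev2_i] := cone_levels i;
  have le_i : (i <= k.*2)%N by rewrite -size_symmetric_steps -ltnS.
  exact: within0.
rewrite /= ?[Num.min _ _]lev1_i ?[Num.max _ _]lev2_i -/(stair_deg e g i).
case: ifP => lt_i; last exact: within0.
by apply: within_cone_y; rewrite ?stair_deg_mirror ?fold_index_mirror //; lia.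
Qed.

(** The cancellation of y_i against z_i + z_(2k-i), for all i < k at once. *)
Lemma cone_retract : deformation_retract cone halves.
Proof.
apply: (deformation_retract_gens fold_map_within unfold_map_within fold_homotopy_within).
- case=> i; rewrite -diff_vec -[fold_map _]Ulin_ext_vec ?cone_vec_y ?cone_vec_z.
    by rewrite fold_chain_y // -size_symmetric_steps -ltnS.
  by rewrite fold_chain_z // -size_symmetric_steps -ltnS.
- case=> i; rewrite -diff_vec -[unfold_map _]Ulin_ext_vec ?half_vec_y ?half_vec_z.
    by rewrite unfold_chain_y // -ltnS.
  by rewrite unfold_chain_z // -ltnS.
- case=> i; rewrite -[unfold_map _]Ulin_ext_vec ?half_vec_y ?half_vec_z.
    by rewrite unfoldK_y // -ltnS.
  by rewrite unfoldK_z // -ltnS.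
case=> i; rewrite -diff_vec -[fold_map _]Ulin_ext_vec -[fold_homotopy _]Ulin_ext_vec
  ?cone_vec_y ?cone_vec_z.
  by rewrite foldK_y // -size_symmetric_steps -ltnS.
by rewrite foldK_z // -size_symmetric_steps -ltnS.
Qed.

End Folding.

(** * The decomposition *)

(** The half that is cut is the one in C if x_k is active and the one in C[1],
    with its grading one higher, if not. *)
Lemma involutive_staircase_retract e (a : seq nat) p g :
    (0 < size a)%N -> (end_vertex e a p).1 = (end_vertex e a p).2 ->
  let c := active e (size a) in
  let g_cut := if c then g else g + 1 in
  let g_full := if c then g + 1 else g in
  deformation_retract
    (@involutive_complex (staircase e (a ++ rev a) p g) (@rev_ord _))
    (dsum (dsum (single_vertex (end_vertex e a p) (stair_deg e g_cut (size a)))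
                (staircase e (take (size a).-1 a) p g_cut))
          (staircase e a p g_full)).
Proof.
move=> a_gt0 diag c g_cut g_full.
apply: deformation_retract_trans (cone_retract g a_gt0 diag) _.
apply: relabelling_retract; rewrite {}/g_cut {}/g_full -/c; case: c => /=.
  apply: relabelling_trans (relabelling_dsumC _ _) _.
  by apply: relabelling_dsum; [apply: cut_staircase_true | apply: cut_staircase_false].
by apply: relabelling_dsum; [apply: cut_staircase_true | apply: cut_staircase_false].
Qed.

Lemma equivalent_of_retract (A B : bifiltered) e b p g :
    odd (size b) -> deformation_retract A (dsum B (staircase e b p g)) ->
  equivalent_up_to_acyclic A B.
Proof.
move=> odd_b AB; exists (staircase e b p g); split.
- exact: staircase_complex.
- exact: staircase_acyclic.
exact: deformation_retract_equivalent.
Qed.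

Lemma tuple_steps_sum (k : nat) (a : k.-tuple nat) (P : pred nat) :
  \sum_(j < size a | P j) (nth 0%N a j)%:Z = \sum_(i < k | P i) (tnth a i)%:Z.
Proof.
rewrite -(big_mkord P (fun j => (nth 0%N a j)%:Z)) size_tuple big_mkord.
by apply: eq_bigr => i _; rewrite (tnth_nth 0%N).
Qed.

Lemma end_vertex_diagonal e (k : nat) (a : k.-tuple nat) :
  let s : int := \sum_(i < k) (tnth a i)%:Z in
  let d : int := \sum_(i < k | odd i.+1) (tnth a i)%:Z in
  end_vertex e a (if e is Positive then (0, s) else (- s, 0)) =
    if e is Positive then (d, d) else (- d, - d).
Proof.
move=> s d; rewrite /end_vertex vertexE.
rewrite (tuple_steps_sum a (fun j => active e j.+1)).
rewrite (tuple_steps_sum a (fun j => ~~ active e j.+1)).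
have sE : s = d + \sum_(i < k | ~~ odd i.+1) (tnth a i)%:Z.
  by rewrite /s (bigID (fun i : 'I_k => odd i.+1)).
have dE : \sum_(i < k | active e i.+1) (tnth a i)%:Z = if e is Positive then d else s - d.
  case: e; first by apply: eq_bigl => i; rewrite /active eqb_id.
  by rewrite sE addrC addKr; apply: eq_bigl => i; rewrite /active eqbF_neg.
have dE' : \sum_(i < k | ~~ active e i.+1) (tnth a i)%:Z =
    if e is Positive then s - d else d.
  case: e {dE}; last by apply: eq_bigl => i; rewrite /active eqbF_neg negbK.
  by rewrite sE addrC addKr; apply: eq_bigl => i; rewrite /active eqb_id.
rewrite dE dE'; case: e {dE dE'} => /=; congr (_, _); lia.
Qed.

Theorem theorem7 (k : nat) (a : k.-tuple nat) (k_gt0 : (0 < k)%N)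
    (a_gt0 : forall i : 'I_k, (0 < tnth a i)%N) :
  let s : int := \sum_(i < k) (tnth a i)%:Z in
  let d : int := \sum_(i < k | odd i.+1) (tnth a i)%:Z in
  [/\ ~~ odd k ->
        equivalent_up_to_acyclic (staircase_involutive Positive a)
          (dsum (single_vertex (d, d) 1) (staircase Positive a (0, s) 0))
        /\ end_vertex Positive a (0, s) = (d, d),
      odd k ->
        equivalent_up_to_acyclic (staircase_involutive Positive a)
          (dsum (single_vertex (d, d) 1)
                (staircase Positive (take k.-1 a) (0, s) 0)),
      ~~ odd k ->
        equivalent_up_to_acyclic (staircase_involutive Negative a)
          (dsum (single_vertex (- d, - d) 0) (staircase Negative a (- s, 0) 1))
        /\ end_vertex Negative a (- s, 0) = (- d, - d)
    & odd k ->
        equivalent_up_to_acyclic (staircase_involutive Negative a)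
          (dsum (single_vertex (- d, - d) 0)
                (staircase Negative (take k.-1 a) (- s, 0) 1))].
Proof.
move=> s d; have size_a : size a = k by rewrite size_tuple.
have size_gt0 : (0 < size a)%N by rewrite size_a.
have end_pos : end_vertex Positive a (0, s) = (d, d).
  exact: (end_vertex_diagonal Positive).
have end_neg : end_vertex Negative a (- s, 0) = (- d, - d).
  exact: (end_vertex_diagonal Negative).
have := @involutive_staircase_retract Positive a (0, s) 0 size_gt0.
have := @involutive_staircase_retract Negative a (- s, 0) 0 size_gt0.
rewrite end_pos end_neg size_a /active /stair_deg => /(_ erefl) neg /(_ erefl) pos.
have odd_cut : ~~ odd k -> odd (size (take k.-1 a)).
  move=> even_k; rewrite size_takel ?size_a ?leq_pred //.
  by rewrite -[odd _]negbK -/(odd _.+1) prednK.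
split=> odd_k; rewrite ?odd_k ?(negbTE odd_k) /= in pos neg.
- split=> //; apply: (equivalent_of_retract (odd_cut odd_k)).
  apply: deformation_retract_trans pos _.
  by apply: relabelling_retract; apply: relabelling_dsumAC.
- by apply: equivalent_of_retract pos; rewrite size_a.
- split=> //; apply: (equivalent_of_retract (odd_cut odd_k)).
  apply: deformation_retract_trans neg _.
  by apply: relabelling_retract; apply: relabelling_dsumAC.
by apply: equivalent_of_retract neg; rewrite size_a.
Qed.
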